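(* Suppose that $n>1$ is an integer that is not divisible by $3$. The $(3,n)$-rational $q,t$-Catalan polynomial $C_{3,n}(q,t)=\sum_\pi q^{\mathrm{dinv}(\pi)}t^{\mathrm{area}(\pi)}$ (sum over all $(3,n)$-Dyck paths $\pi$) is symmetric in $q$ and $t$, i.e. $C_{3,n}(q,t)=C_{3,n}(t,q)$.
   Context: Set $m=3$, and let $n$ be a positive integer coprime to $3$. Diagram and paths. The $(m,n)$-lattice is the grid of unit squares (cells) filling the rectangle with southwest corner $(0,0)$ and northeast corner $(m,n)$. Cell $(u,v)$, $1\le u\le m$, $1\le v\le n$, is the unit square whose northeast corner is the point $(u,v)$; it lies in column $u$ and row $v$. Its rank is $\gamma(u,v)=mn-un-(n+1-v)m$ (distinct cells have distinct ranks). An $(m,n)$-Dyck path is a lattice path from $(0,0)$ to $(m,n)$ consisting of unit north and east steps and staying weakly above the diagonal $y=\frac{n}{m}x$. It splits the cells into those above the path (on its northwest side) and those below the path (on its southeast side). Statistics on paths. For a cell $(x,y)$ above $\pi$, $\mathrm{arm}(x,y)$ is the number of cells above $\pi$ in the same row strictly east of $(x,y)$, and $\mathrm{leg}(x,y)$ is the number of cells above $\pi$ in the same column strictly south of $(x,y)$. Then $\mathrm{area}(\pi)$ is the number of cells below $\pi$ with positive rank, and $\mathrm{dinv}(\pi)$ is the number of cells $(x,y)$ above $\pi$ with $\frac{\mathrm{arm}(x,y)}{\mathrm{leg}(x,y)+1}<\frac{m}{n}<\frac{\mathrm{arm}(x,y)+1}{\mathrm{leg}(x,y)}$ (division by zero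 is interpreted as $\infty$). *)

(* Defs.v *)
From HB Require Import structures.
From mathcomp Require Import all_boot all_order all_algebra.
From mathcomp Require Import mpoly.

Set Implicit Arguments.
Unset Strict Implicit.
Unset Printing Implicit Defensive.

Import Order.TTheory GRing.Theory Num.Theory.
Local Open Scope ring_scope.

Definition north : bool := true.
Definition east : bool := false.

Section RationalDyckPaths.

Variables m n : nat.

Definition lattice_word := (m + n).-tuple bool.

(* The vertex reached after k steps is (xpos p k, ypos p k). *)
Definition xpos (p : lattice_word) (k : nat) : nat :=
  count_mem east (take k p).
Definition ypos (p : lattice_word) (k : nat) : nat :=
  count_mem north (take k p).

(* Unit steps are segments, so it suffices that every vertex lies weakly
   above the diagonal. *)
Definition dyck_path (p : lattice_word) : bool :=
  [&& xpos p (m + n) == m, ypos p (m + n) == n &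
   [forall k : 'I_(m + n).+1,
     n%:R / m%:R * (xpos p k)%:R <= (ypos p k)%:R :> rat]].

(* Ordinals start at 0: the element (i, j) is the cell whose northeast corner
   is the point (i + 1, j + 1). *)
Definition cell := ('I_m * 'I_n)%type.
Definition col (c : cell) : nat := c.1.+1.
Definition row (c : cell) : nat := c.2.+1.

Definition rank (c : cell) : int :=
  m%:Z * n%:Z - (col c)%:Z * n%:Z - (n%:Z + 1 - (row c)%:Z) * m%:Z.

(* A cell is northwest of the path iff the path visits a vertex weakly
   southeast of the southeast corner (col c, row c - 1) of the cell. *)
Definition above (p : lattice_word) (c : cell) : bool :=
  [exists k : 'I_(m + n).+1, (col c <= xpos p k)%N && (ypos p k < row c)%N].

Definition arm (p : lattice_word) (c : cell) : nat :=
  #|[set d : cell | [&& above p d, row d == row c & (col c < col d)%N]]|.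

Definition leg (p : lattice_word) (c : cell) : nat :=
  #|[set d : cell | [&& above p d, col d == col c & (row d < row c)%N]]|.

Definition area (p : lattice_word) : nat :=
  #|[set c : cell | ~~ above p c & 0 < rank c]|.

(* The disjunct leg p c == 0 encodes (arm + 1) / 0 = oo. *)
Definition dinv (p : lattice_word) : nat :=
  #|[set c : cell | [&& above p c,
      (arm p c)%:R / (leg p c).+1%:R < m%:R / n%:R :> rat &
      (leg p c == 0%N) ||
        (m%:R / n%:R < (arm p c).+1%:R / (leg p c)%:R :> rat)]]|.

End RationalDyckPaths.

Definition q : {mpoly int[2]} := 'X_0.
Definition t : {mpoly int[2]} := 'X_1.

Definition qt_catalan (m n : nat) : {mpoly int[2]} :=
  \sum_(p : lattice_word m n | dyck_path p) q ^+ dinv p * t ^+ area p.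

(* Main.v *)
Require Import Defs.
From HB Require Import structures.
From mathcomp Require Import all_boot all_order all_algebra.
From mathcomp Require Import mpoly.
From mathcomp Require Import zify.

Set Implicit Arguments.
Unset Strict Implicit.
Unset Printing Implicit Defensive.

Import Order.TTheory GRing.Theory Num.Theory.
Local Open Scope ring_scope.

(** A (3,n)-Dyck path is determined by the heights h1 <= h2 of its first two
    east steps, the third one being forced to height n, and both statistics
    are explicit in these heights: with f = n %/ 3,
      area = h1 + h2 - (n + 1),
      dinv = min(h2 - h1, f + 1) + (n - max(h2, h1 + f)) + (n - h2)
    (area_profile, dinv_profile).

    Symmetry follows from two facts about the pair (dinv, area).  It is
    injective on Dyck paths, so the polynomial is multiplicity free, and it
    attains exactly the pairs (D, A) for which, writing B = n - 1 - D - A,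
    one has 0 <= B <= min(D, A) (mem_dinv_area).  The latter condition does
    not distinguish D from A.

    To see why this is so, let a = n - h1 and b = n - h2 be the numbers
    of cells above the path in the first two columns, so that b <= f and
    a <= n - 1 - f.  There are three regimes (dinv_regimes).
    - If a <= f then dinv = a and B = b; for fixed B this gives the values
      B, B + 1, ..., f of dinv.
    - If a > f and a - b <= f then dinv = 2a - f and B = f - (a - b); this
      gives the values f + 2, f + 4, ... of dinv.
    - If a - b > f then dinv = 2b + f + 1 and B = (a - b) - f - 1; this gives
      the values f + 1, f + 3, ... of dinv.
    For each B the three progressions are disjoint and together exhaust the
    interval from B to n - 1 - 2B, which is the condition B <= min(D, A).  The
    upper ends of the last two progressions are 3f - 2B and 3f - 1 - 2B when
    n = 3f + 1, and 3f - 2B and 3f + 1 - 2B when n = 3f + 2; the larger one is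
    n - 1 - 2B in both cases. *)

(** * Comparing fractions and counting cells *)

Lemma ltr_nat_frac (a b c d : nat) : (0 < b)%N -> (0 < d)%N ->
  (a%:R / b%:R < c%:R / d%:R :> rat) = (a * d < c * b)%N.
Proof.
move=> b0 d0; rewrite ltr_pdivrMr ?ltr0n // mulrAC ltr_pdivlMr ?ltr0n //.
by rewrite -!natrM ltr_nat.
Qed.

(** With the convention that a fraction of denominator 0 is infinite, the
    cross-multiplied inequality needs no case distinction. *)
Lemma ltr_nat_frac_infty (a b c d : nat) : (0 < b)%N -> (0 < c)%N ->
  (d == 0%N) || (a%:R / b%:R < c%:R / d%:R :> rat) = (a * d < c * b)%N.
Proof.
move=> b0 c0; have [->|d0] := posnP d; first by rewrite muln0 muln_gt0 c0.
by rewrite ltr_nat_frac // eqn0Ngt d0.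
Qed.

Lemma sum_ord_interval (n l h : nat) (P : nat -> bool) : (h <= n)%N ->
  (forall j, (j < n)%N -> P j = (l <= j < h)%N) ->
  (\sum_(j < n) P j = h - l)%N.
Proof.
move=> hn HP; rewrite -(minn_idPr hn).
transitivity (\sum_(j < n) (l <= j < h)%N)%N.
  by apply: eq_bigr => j _; rewrite HP.
elim: {hn HP}n => [|n IH]; first by rewrite big_ord0; lia.
by rewrite big_ord_recr /= IH; lia.
Qed.

Lemma card_cells3 (n : nat) (P : nat -> nat -> bool) :
  (#|[set c : cell 3 n | P c.1 c.2]| =
   \sum_(j < n) P 0 j + \sum_(j < n) P 1 j + \sum_(j < n) P 2 j)%N.
Proof.
rewrite cardsE -sum1_card big_mkcond /=.
rewrite -(pair_bigA _ (fun (i : 'I_3) (j : 'I_n) => (P i j : nat))) /=.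
by rewrite !big_ord_recl big_ord0 addn0 addnA.
Qed.

(** * The path with given heights of its east steps *)

Definition profile (n h1 h2 : nat) : seq bool :=
  nseq h1 north ++ east :: nseq (h2 - h1) north ++ east ::
  nseq (n - h2) north ++ [:: east].

Lemma size_profile (n h1 h2 : nat) : (h1 <= h2 <= n)%N ->
  size (profile n h1 h2) = (3 + n)%N.
Proof. by do 3?rewrite size_cat size_nseq /=; lia. Qed.

Lemma count_east_take (h k : nat) (s : seq bool) :
  count_mem east (take k (nseq h north ++ east :: s)) =
  if (k <= h)%N then 0%N else (count_mem east (take (k - h).-1 s)).+1.
Proof.
rewrite take_cat size_nseq.
have [kh|hk|->] := ltngtP k h.
- by rewrite take_nseq ?(ltnW kh) // count_nseq.
- rewrite count_cat count_nseq add0n.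
  by case: (k - h)%N (subn_gt0 h k) => [|i] /=; rewrite hk.
by rewrite subnn cats0 count_nseq.
Qed.

Lemma xpos_profile (n h1 h2 k : nat) (p : lattice_word 3 n) :
    (h1 <= h2 <= n)%N -> tval p = profile n h1 h2 ->
  xpos p k = ((h1 < k) + (h2.+1 < k) + (n.+2 < k))%N.
Proof.
move=> h12 ep; rewrite /xpos ep.
rewrite !count_east_take /=.
by do 3?case: ifP => ?; lia.
Qed.

Lemma ypos_subn (m n k : nat) (p : lattice_word m n) : (k <= m + n)%N ->
  ypos p k = (k - xpos p k)%N.
Proof.
move=> kmn; suff: (xpos p k + ypos p k)%N = k by lia.
rewrite -[RHS](@size_takel k _ p); last by rewrite size_tuple.
rewrite -(count_predC (pred1 east)).
by congr addn; apply: eq_count; case.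
Qed.

Lemma above_profile (n h1 h2 : nat) (p : lattice_word 3 n) (c : cell 3 n) :
    (h1 <= h2 <= n)%N -> tval p = profile n h1 h2 ->
  above p c = ((c.1 == 0%N :> nat) && (h1 <= c.2)%N) ||
              ((c.1 == 1%N :> nat) && (h2 <= c.2)%N).
Proof.
case: c => i j h12 ep; rewrite /above /Defs.col /Defs.row /=.
have jn := ltn_ord j; have i3 := ltn_ord i.
apply/existsP/idP => [[k]|H].
  have k3n := ltn_ord k; rewrite ypos_subn // (xpos_profile _ h12 ep).
  by lia.
(* The vertex that ends the east step crossing the column of the cell. *)
have K : ((if i == 0%N :> nat then h1.+1 else h2.+2) < (3 + n).+1)%N.
  by case: ifP; lia.
exists (Ordinal K); rewrite ypos_subn // (xpos_profile _ h12 ep) /=.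
by move: H; case: ifP; lia.
Qed.

(** * Arm, leg, area and dinv *)

(** The row of a cell above the path in the first column meets at most one
    further cell above the path, the one in the second column; the third
    column has none. *)
Lemma arm_profile (n h1 h2 : nat) (p : lattice_word 3 n) (c : cell 3 n) :
    (h1 <= h2 <= n)%N -> tval p = profile n h1 h2 ->
  arm p c = ((c.1 == 0%N :> nat) && (h2 <= c.2)%N)%N :> nat.
Proof.
move=> h12 ep; rewrite /arm; have jn := ltn_ord c.2.
pose P (i j : nat) := [&& ((i == 0%N) && (h1 <= j)%N) ||
   ((i == 1%N) && (h2 <= j)%N), j == c.2 & (c.1 < i)%N].
rewrite (_ : finset _ = [set d : cell 3 n | P d.1 d.2]); last first.
  by apply/setP => d; rewrite !inE (above_profile _ h12 ep).
rewrite card_cells3 (@sum_ord_interval n 0 0) //; last by rewrite /P; lia.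
rewrite (@sum_ord_interval n c.2
           (c.2 + ((c.1 == 0%N :> nat) && (h2 <= c.2)%N))%N);
  [|by lia|by rewrite /P; lia].
by rewrite (@sum_ord_interval n 0 0) //; rewrite /P; lia.
Qed.

Lemma leg_profile (n h1 h2 : nat) (p : lattice_word 3 n) (c : cell 3 n) :
    (h1 <= h2 <= n)%N -> tval p = profile n h1 h2 -> above p c ->
  leg p c = (c.2 - (if c.1 == 0%N :> nat then h1 else h2))%N.
Proof.
move=> h12 ep; rewrite (above_profile _ h12 ep) => ac.
rewrite /leg; have jn := ltn_ord c.2.
pose P (i j : nat) := [&& ((i == 0%N) && (h1 <= j)%N) ||
   ((i == 1%N) && (h2 <= j)%N), i == c.1 & (j < c.2)%N].
rewrite (_ : finset _ = [set d : cell 3 n | P d.1 d.2]); last first.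
  by apply/setP => d; rewrite !inE (above_profile _ h12 ep).
rewrite card_cells3.
rewrite (@sum_ord_interval n h1 (if c.1 == 0%N :> nat then c.2 : nat else 0%N));
  [|by case: ifP; lia|by rewrite /P; case: ifP; lia].
rewrite (@sum_ord_interval n h2 (if c.1 == 1%N :> nat then c.2 : nat else 0%N));
  [|by case: ifP; lia|by rewrite /P; case: ifP; lia].
rewrite (@sum_ord_interval n 0 0) //.
by do 2?case: ifP; lia.
Qed.

(** The cells of positive rank in the first column are those whose lower edge
    is above height n/3, and in the second column those whose lower edge is
    above height 2n/3; their total number is n - 1 because n is prime to 3. *)
Lemma area_profile (n h1 h2 : nat) (p : lattice_word 3 n) :
    ~~ (3 %| n)%N ->
    (h1 <= h2 <= n)%N -> tval p = profile n h1 h2 ->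
    (n <= 3 * h1)%N -> (2 * n <= 3 * h2)%N ->
  area p = (h1 + h2 - n.+1)%N.
Proof.
move=> n3 h12 ep d1 d2; rewrite /area.
pose P (i j : nat) := ~~ (((i == 0%N) && (h1 <= j)%N) ||
   ((i == 1%N) && (h2 <= j)%N)) && (i.+1 * n + 3 * (n - j) < 3 * n)%N.
rewrite (_ : finset _ = [set d : cell 3 n | P d.1 d.2]); last first.
  apply/setP => d; rewrite !inE (above_profile _ h12 ep) /P; congr andb.
  rewrite /Defs.rank /Defs.col /Defs.row; have := ltn_ord d.2.
  (* Fixing the column makes the inequality linear in n. *)
  have [->|->|->] : [\/ d.1 = 0%N :> nat, d.1 = 1%N :> nat | d.1 = 2%N :> nat].
  - by case: d.1 => [[|[|[|]]]] //; [constructor 1|constructor 2|constructor 3].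
  - by lia.
  - by lia.
  - by move: (nat_of_ord d.2) => j; clear; lia.
rewrite card_cells3.
rewrite (@sum_ord_interval n (n %/ 3).+1 h1); [|by lia|by rewrite /P; lia].
rewrite (@sum_ord_interval n (n - n %/ 3) h2); [|by lia|by rewrite /P; lia].
rewrite (@sum_ord_interval n 0 0); [|by lia|by rewrite /P; lia].
lia.
Qed.

(** A cell of arm 0 counts iff 3 leg < n, and a cell of arm 1 iff
    n < 3 (leg + 1) and 3 leg < 2n, the last being automatic on a Dyck path.
    In the first column the arm is 0 below height h2 and 1 above it, which
    yields the first two summands; every cell above the path in the second
    column counts, because there are at most n/3 of them. *)
Lemma dinv_profile (n h1 h2 : nat) (p : lattice_word 3 n) :
    ~~ (3 %| n)%N ->
    (h1 <= h2 <= n)%N -> tval p = profile n h1 h2 ->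
    (n <= 3 * h1)%N -> (2 * n <= 3 * h2)%N ->
  dinv p = (minn (h2 - h1) (n %/ 3).+1 + (n - maxn h2 (h1 + n %/ 3))
            + (n - h2))%N.
Proof.
move=> n3 h12 ep d1 d2; rewrite /dinv.
pose P (i j : nat) :=
  ((i == 0%N) && ((h1 <= j < minn h2 (h1 + (n %/ 3).+1))%N ||
                  (maxn h2 (h1 + n %/ 3) <= j)%N)) ||
  ((i == 1%N) && (h2 <= j)%N).
rewrite (_ : finset _ = [set d : cell 3 n | P d.1 d.2]); last first.
  apply/setP => d; rewrite !inE /P.
  have [ad|] := boolP (above p d); last first.
    by rewrite (above_profile _ h12 ep) /=; lia.
  rewrite ltr_nat_frac ?ltr_nat_frac_infty //; [|by lia|by lia].
  rewrite (leg_profile h12 ep ad) (arm_profile _ h12 ep) /=.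
  move: ad; rewrite (above_profile _ h12 ep); have jn := ltn_ord d.2.
  move: (nat_of_ord d.2) jn => j jn.
  by case: (nat_of_ord d.1) => [|[|i]]; case: (leqP h2 j) => h2d /=;
    rewrite ?muln1 ?mul1n ?mul0n; lia.
rewrite card_cells3.
rewrite (eq_bigr (fun j : 'I_n =>
    (h1 <= j < minn h2 (h1 + (n %/ 3).+1))%N +
    (maxn h2 (h1 + n %/ 3) <= j < n)%N)%N); last first.
  by move=> j _; rewrite /P; have := ltn_ord j; lia.
rewrite big_split /=.
rewrite (@sum_ord_interval n h1 (minn h2 (h1 + (n %/ 3).+1))
  (fun j => (h1 <= j < minn h2 (h1 + (n %/ 3).+1))%N)) //; last by lia.
rewrite (@sum_ord_interval n (maxn h2 (h1 + n %/ 3)) n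
  (fun j => (maxn h2 (h1 + n %/ 3) <= j < n)%N)) //.
rewrite (@sum_ord_interval n h2 n (P 1%N)); [|by lia|by rewrite /P; lia].
rewrite (@sum_ord_interval n 0 0 (P 2%N)); [|by lia|by rewrite /P; lia].
lia.
Qed.

(** * Dyck paths as pairs of heights *)

(** Only the ends of the first two east steps need to be tested against the
    diagonal: north steps move away from it. *)
Lemma dyck_profile (n h1 h2 : nat) (p : lattice_word 3 n) :
    (h1 <= h2 <= n)%N -> tval p = profile n h1 h2 ->
  dyck_path p = (n <= 3 * h1)%N && (2 * n <= 3 * h2)%N.
Proof.
move=> h12 ep; rewrite /dyck_path ypos_subn // (xpos_profile _ h12 ep).
have -> : ((h1 < 3 + n) + (h2.+1 < 3 + n) + (n.+2 < 3 + n) = 3)%N by lia.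
rewrite eqxx addKn eqxx /=.
have slope (k : 'I_(3 + n).+1) :
    (n%:R / 3%:R * (xpos p k)%:R <= (ypos p k)%:R :> rat) =
    (n * xpos p k <= 3 * ypos p k)%N.
  by rewrite mulrAC ler_pdivrMr ?ltr0n // -!natrM ler_nat (mulnC 3).
apply/forallP/idP => [H|H k].
  have k1 : (h1.+1 < (3 + n).+1)%N by lia.
  have k2 : (h2.+2 < (3 + n).+1)%N by lia.
  move: (H (Ordinal k1)) (H (Ordinal k2)).
  by rewrite !slope !ypos_subn // !(xpos_profile _ h12 ep) /=; nia.
rewrite slope; have := ltn_ord k; rewrite ltnS => k3n.
rewrite ypos_subn // !(xpos_profile _ h12 ep).
by do 3 case: ltnP => ?; lia.
Qed.

Lemma split_first_east (s : seq bool) : (0 < count_mem east s)%N ->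
  exists h s', s = nseq h north ++ east :: s'.
Proof.
elim: s => // -[] s IH /= H; last by exists 0%N, s.
by have [|h [s' ->]] := IH; [exact: H | exists h.+1, s'].
Qed.

Lemma dyck_path_profile (n : nat) (p : lattice_word 3 n) : dyck_path p ->
  exists h1 h2, (h1 <= h2 <= n)%N /\ tval p = profile n h1 h2.
Proof.
case/and3P => /eqP px _ /forallP pd.
have sp : size p = (3 + n)%N by rewrite size_tuple.
move: px; rewrite /xpos take_oversize ?sp // => px.
have [|h [s e1]] := @split_first_east p; first by rewrite px.
have c1 : count_mem east s = 2%N.
  by move: px; rewrite e1 count_cat count_nseq /=; lia.
have [|a [s2 e2]] := @split_first_east s; first by rewrite c1.
have c2 : count_mem east s2 = 1%N.
  by move: c1; rewrite e2 count_cat count_nseq /=; lia.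
have [|b [s3 e3]] := @split_first_east s2; first by rewrite c2.
have c3 : count_mem east s3 = 0%N.
  by move: c2; rewrite e3 count_cat count_nseq /=; lia.
move: sp; rewrite e1 e2 e3; do 3!rewrite size_cat size_nseq /=; move=> sp.
(* The end of the third east step must be (3, n), so no north step follows. *)
have K : (h + a + b + 3 < (3 + n).+1)%N by lia.
have T0 i : count_mem east (take i s3) = 0%N.
  by move: c3; rewrite -{1}(cat_take_drop i s3) count_cat; lia.
have := pd (Ordinal K); rewrite ypos_subn //= /xpos e1 e2 e3.
rewrite !count_east_take T0 !ifF; [|by lia|by lia|by lia].
rewrite mulrAC ler_pdivrMr ?ltr0n // -!natrM ler_nat => ns.
have s30 : s3 = [::] by apply: size0nil; lia.
exists h, (h + a)%N; split; first by lia.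
rewrite s30 /profile addKn; congr (_ ++ _ :: _ ++ _ :: nseq _ _ ++ _); lia.
Qed.

(** * The three regimes of dinv *)

(** The value D of dinv in its three regimes, free of truncated subtractions.
    In terms of a = n - h1 and b = n - h2 they are: a <= f, then a > f with
    a - b <= f, then a - b > f. *)
Definition dinv_regimes (n f h1 h2 D : nat) : Prop :=
  [\/ (n <= h1 + f)%N /\ (D + h1 = n)%N,
      [/\ h1 + f < n, h2 <= h1 + f & D + f + 2 * h1 = 2 * n]%N
    | (h1 + f < h2)%N /\ (D + 2 * h2 = 2 * n + f.+1)%N].

Lemma dinv_regimesP (n f h1 h2 : nat) : (h1 <= h2 <= n)%N ->
  dinv_regimes n f h1 h2
    (minn (h2 - h1) f.+1 + (n - maxn h2 (h1 + f)) + (n - h2)).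
Proof.
move=> /andP[h12 h2n].
have [hf|hf] := leqP h2 (h1 + f); last first.
  have /minn_idPr-> : (f.+1 <= h2 - h1)%N by lia.
  by constructor 3; split; lia.
have /minn_idPl-> : (h2 - h1 <= f.+1)%N by lia.
have [nf|nf] := leqP n (h1 + f).
  by constructor 1; split; lia.
by constructor 2; split; lia.
Qed.

(** In each regime D and the sum of the heights determine both heights.  The
    first regime has D <= f and the other two have D > f; the parities of
    D - f tell the last two apart. *)
Lemma dinv_regimes_inj (n f h1 h2 h1' h2' D : nat) :
    (h1 <= h2 <= n)%N -> (h1' <= h2' <= n)%N -> (h1 + h2 = h1' + h2')%N ->
    dinv_regimes n f h1 h2 D -> dinv_regimes n f h1' h2' D ->
  h1 = h1' /\ h2 = h2'.
Proof.
move=> h12 h12' sum_h R R'; suff e1 : h1 = h1' by lia.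
by case: R => [[? ?]|[? ? ?]|[? ?]];
   case: R' => [[? ?]|[? ? ?]|[? ?]]; lia.
Qed.

Lemma dinv_regimes_fun (n f h1 h2 D D' : nat) : (h2 <= n)%N ->
  dinv_regimes n f h1 h2 D -> dinv_regimes n f h1 h2 D' -> D = D'.
Proof.
by move=> h2n; case=> [[? ?]|[? ? ?]|[? ?]];
   case=> [[? ?]|[? ? ?]|[? ?]]; lia.
Qed.

(** The three inequalities say that B = n - 1 - D - A satisfies
    0 <= B <= min(D, A). *)
Lemma dinv_regimes_bounds (n f h1 h2 D A : nat) :
    (3 * f < n < 3 * f.+1)%N -> (h1 <= h2 <= n)%N ->
    (n <= 3 * h1)%N -> (2 * n <= 3 * h2)%N ->
    dinv_regimes n f h1 h2 D -> (h1 + h2 = A + n.+1)%N ->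
  [&& (D + A < n), (n <= (2 * D + A).+1) & (n <= (D + 2 * A).+1)]%N.
Proof.
move=> nf h12 d1 d2 R eA.
by case: R => [[? ?]|[? ? ?]|[? ?]]; apply/and3P; split; lia.
Qed.

(** A pair (D, A) fixes B, and the regime that can produce D is read off from
    its size and parity; the equations of that regime are then solved for
    a = n - h1 and b = n - h2. *)
Lemma dinv_regimes_surj (n f D A : nat) : (3 * f < n < 3 * f.+1)%N ->
    [&& (D + A < n), (n <= (2 * D + A).+1) & (n <= (D + 2 * A).+1)]%N ->
  exists h1 h2, [/\ (h1 <= h2 <= n)%N, (n <= 3 * h1)%N, (2 * n <= 3 * h2)%N,
    dinv_regimes n f h1 h2 D & (h1 + h2 = A + n.+1)%N].
Proof.
move=> nf /and3P[]; pose B := (n.-1 - D - A)%N => DA DDA DAA.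
have eB : (B + D + A).+1 = n by rewrite /B; lia.
move: B eB => B eB.
have [Df|fD] := leqP D f.
  (* a = D and b = B *)
  exists (n - D)%N, (n - B)%N.
  by split; [lia | lia | lia | constructor 1; split; lia | lia].
have := odd_double_half (D - f); move: (_./2) => k; case: odd => eD.
  (* a = k + f + 1 + B and b = k, from D = f + 1 + 2k *)
  exists (n - (k + f.+1 + B))%N, (n - k)%N.
  by split; [lia | lia | lia | constructor 3; split; lia | lia].
(* a = f + k and b = k + B, from D = f + 2k *)
exists (n - (f + k))%N, (n - (k + B))%N.
by split; [lia | lia | lia | constructor 2; split; lia | lia].
Qed.

(** * The distribution of (dinv, area) *)

Lemma dinv_area_inj (n : nat) : ~~ (3 %| n)%N ->
  {in @dyck_path 3 n &, injective (fun p => (dinv p, area p))}.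
Proof.
move=> n3 p p' dp dp'.
have [h1 [h2 [h12 ep]]] := dyck_path_profile dp.
have [h1' [h2' [h12' ep']]] := dyck_path_profile dp'.
move: (dp : dyck_path p) (dp' : dyck_path p').
rewrite (dyck_profile h12 ep) (dyck_profile h12' ep').
move=> /andP[d1 d2] /andP[d1' d2'].
rewrite (dinv_profile n3 h12 ep) // (dinv_profile n3 h12' ep') //.
rewrite (area_profile n3 h12 ep) // (area_profile n3 h12' ep') //.
case=> eD eA; apply: val_inj; rewrite /= ep ep'.
(* Heights of a Dyck path exceed n in total, so the area is not truncated. *)
have A1 : (n < h1 + h2)%N by clear -n3 d1 d2; lia.
have A2 : (n < h1' + h2')%N by clear -n3 d1' d2'; lia.
have sum_h : (h1 + h2 = h1' + h2')%N by clear -eA A1 A2; lia.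
have R := dinv_regimesP (n %/ 3) h12.
have R' := dinv_regimesP (n %/ 3) h12'.
rewrite eD in R.
by have [-> ->] := dinv_regimes_inj h12 h12' sum_h R R'.
Qed.

Lemma mem_dinv_area (n D A : nat) : ~~ (3 %| n)%N ->
  ((D, A) \in [seq (dinv p, area p) | p <- enum (@dyck_path 3 n)]) =
  [&& (D + A < n), (n <= (2 * D + A).+1) & (n <= (D + 2 * A).+1)]%N.
Proof.
move=> n3; have nf : (3 * (n %/ 3) < n < 3 * (n %/ 3).+1)%N by lia.
apply/mapP/idP => [[p]|DA].
  rewrite mem_enum => dp [eD eA].
  have [h1 [h2 [h12 ep]]] := dyck_path_profile dp.
  move: (dp : dyck_path p); rewrite (dyck_profile h12 ep) => /andP[d1 d2].
  apply: (dinv_regimes_bounds nf h12 d1 d2).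
    by rewrite eD (dinv_profile n3 h12 ep d1 d2); apply: dinv_regimesP.
  rewrite eA (area_profile n3 h12 ep d1 d2).
  by clear -n3 d1 d2; lia.
have [h1 [h2 [h12 d1 d2 RD eA]]] := dinv_regimes_surj nf DA.
pose p := Tuple (introT eqP (size_profile h12)).
have ep : tval p = profile n h1 h2 by [].
exists p.
  by rewrite mem_enum; change (dyck_path p); rewrite (dyck_profile h12 ep) d1.
rewrite (dinv_profile n3 h12 ep d1 d2) (area_profile n3 h12 ep d1 d2).
by rewrite eA addnK -(dinv_regimes_fun _ RD (dinv_regimesP _ h12)) //; case: (andP h12).
Qed.

Theorem corollary32 (n : nat) (hn : (1 < n)%N) (h3 : ~~ (3 %| n)%N) :
  qt_catalan 3 n = qt_catalan 3 n \mPo [tuple t; q].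
Proof.
pose F (x : nat * nat) : {mpoly int[2]} := q ^+ x.1 * t ^+ x.2.
pose L := [seq (dinv p, area p) | p <- enum (@dyck_path 3 n)].
have qtE : qt_catalan 3 n = \sum_(x <- L) F x.
  by rewrite big_map big_enum.
have qtC : qt_catalan 3 n \mPo [tuple t; q] =
    \sum_(x <- [seq (x.2, x.1) | x <- L]) F x.
  rewrite qtE raddf_sum !big_map; apply: eq_bigr => x _ /=.
  rewrite /F rmorphM !rmorphXn /= !comp_mpolyXU.
  by rewrite mulrC.
rewrite qtC qtE; apply: perm_big.
have uL : uniq L.
  rewrite map_inj_in_uniq ?enum_uniq // => p p'; rewrite !mem_enum.
  exact: dinv_area_inj.
apply: uniq_perm => //.
  by rewrite map_inj_uniq // => -[? ?] [? ?] /= [-> ->].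
move=> [D A]; rewrite mem_dinv_area //.
apply/idP/mapP => [DA|[[D' A'] + [-> ->]]].
  by exists (A, D) => //; rewrite mem_dinv_area //; lia.
by rewrite mem_dinv_area //=; lia.
Qed.
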